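(* Let $(\mathcal U,U,V)$ be a CR metric $f$-structure and let $\mathscr M$ be a $V$-Banach $U$-module. Then there exists a unique partition $(D_n)_{n\in\mathbb N\cup\{\infty\}}\subset\mathrm{Idem}(U)$ of $\mathbf 1_U$ such that: (i) $\mathscr M$ has local dimension $n$ on $D_n$, for every $n\in\mathbb N$; (ii) given any $n\in\mathbb N$ and $u\in\mathrm{Idem}(U)\setminus\{0\}$ with $u\le D_\infty$, $\mathscr M$ does not have local dimension $n$ on $u$.
   Context: Riesz spaces and $f$-algebras. $\mathbb N=\{1,2,3,\dots\}$, $\mathbb R^+=[0,\infty)$. A Riesz space is a real vector space $U$ with a partial order that is a lattice and satisfies $u\le v\Rightarrow u+w\le v+w$ and ($u\ge 0$, $\lambda\in\mathbb R^+$) $\Rightarrow\lambda u\ge 0$; $\vee,\wedge$ denote sup and inf of two elements, $u^{+}=u\vee 0$, $u^-=(-u)\vee 0$, $|u|=u\vee(-u)$, $U^+=\{u\in U:u\ge 0\}$. A Riesz subspace is a linear subspace closed under $\vee,\wedge$; a Riesz subspace $V\subset U$ is solid if $v\in U$, $u\in V$, $|v|\le|u|$ imply $v\in V$. A family is disjoint if $|u|\wedge|v|=0$ for any two different members (members with different indices). Dedekind complete (resp. $\sigma$-complete): every non-empty (resp. countable non-empty) subset bounded above has a supremum and every such subset bounded below has an infimum. A Dedekind complete partially ordered set $P$ is countably representable (CR) if every non-empty $S\subset P$ bounded above contains a sequence $(s_n)_n\subset S$ with $\sup_ns_n=\sup S$ and every non-empty $S\subset P$ bounded below contains a sequence $(s_n)_n\subset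 S$ with $\inf_ns_n=\inf S$. An $f$-algebra is a Riesz space with an associative, commutative, $\mathbb R$-bilinear multiplication with unit $\mathbf 1_U$ such that $uv\ge0$ for $u,v\ge 0$, and $(uw)\wedge v=0$ whenever $u\wedge v=0$ and $w\ge 0$. An $f$-subalgebra is a Riesz subspace closed under multiplication and containing $\mathbf 1_U$. $\mathrm{Idem}(U)=\{u\in U:u^2=u\}$. A finite partition of $u\in\mathrm{Idem}(U)$ is a finite disjoint family in $\mathrm{Idem}(U)$ with sum $u$; a countable partition of $u$ is a disjoint countably indexed family in $\mathrm{Idem}(U)$ with supremum $u$; $\mathcal P(u)$ is the set of countable partitions of $u$. Simple elements: $\mathcal S(U)=\{\sum_{i=1}^n\lambda_iu_i:\lambda_i\in\mathbb R,\ (u_i)_{i=1}^n\text{ a finite partition of }\mathbf 1_U\}$. An order-preserving map is $\sigma$-order-continuous if it preserves existing suprema of non-decreasing sequences and existing infima of non-increasing sequences. A localisable $f$-algebra is a Dedekind $\sigma$-complete $f$-algebra whose multiplication is $\sigma$-order-continuous on $U^+\times U^+$ and such that every $u\in U^+$ is the supremum of a non-decreasing sequence in $\mathcal S(U)\cap U^+$. Metric notions (products of metric spaces carry the sum distance). A metric Riesz space $(U,\mathsf d_U)$ is a Dedekind $\sigma$-complete Riesz space with a complete distance such that $\mathsf d_U(u,0)=\mathsf d_U(|u|,0)$, $\mathsf d_U(u+w,v+w)=\mathsf d_U(u,v)$, and $\mathsf d_U(u,0)\le\mathsf d_U(v,0)$ whenever $0\le u\le v$. A metric $f$-algebra is a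 localisable $f$-algebra $U$ with a distance $\mathsf d_U$ such that $(U,\mathsf d_U)$ is a metric Riesz space, the multiplication $U\times U\to U$ is continuous, $\mathcal S(U)$ is dense, and $\mathsf d_U(\varepsilon\mathbf 1_U,0)\to0$ as $\varepsilon\searrow0$. A metric $f$-structure is a triple $(\mathcal U,U,V)$ where $\mathcal U$ is a localisable $f$-algebra; $(U,\mathsf d_U)$ is a metric $f$-algebra that is a solid $f$-subalgebra of $\mathcal U$; $(V,\mathsf d_V)$ is a metric Riesz space that is a solid Riesz subspace of $\mathcal U$; $UV=V$ (where $UV=\{uv:u\in U,v\in V\}$) and the multiplication $U\times V\to V$ is continuous; and for any $(u_n)_n\in\mathcal P(\mathbf 1_U)$ and $\varepsilon>0$ there is $\delta>0$ such that, whenever $(v_n)_n\subset V^+$ satisfies $\sum_n\mathsf d_V(u_nv_n,0)\le\delta$, the family $(u_nv_n)_n$ is order-bounded in $V$ and $\mathsf d_V(\sup_nu_nv_n,0)\le\varepsilon$. It is CR if $\mathcal U$, $U$ and $V$ are CR. Modules. A $V$-normed $U$-module is a $U$-module $\mathscr M$ (a real vector space via $\lambda v=(\lambda\mathbf 1_U)\cdot v$) with a map $|\cdot|\colon\mathscr M\to V^+$ such that $|v|=0\iff v=0$, $|v+w|\le|v|+|w|$, $|u\cdot v|=|u||v|$, and the glueing property holds: if $(u_n)_n\in\mathcal P(\mathbf 1_U)$ and $(v_n)_n\subset\mathscr M$ are such that $(|u_n\cdot v_n|)_n$ is order-bounded in $V$ (one writes $(u_n,v_n)_n\in\mathrm{Adm}(\mathscr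 M)$), then there is a (necessarily unique) $v\in\mathscr M$ with $u_n\cdot v=u_n\cdot v_n$ for all $n$, denoted $\sum_{n\in\mathbb N}u_n\cdot v_n$. $\mathscr M$ has the distance $\mathsf d_{\mathscr M}(v,w)=\mathsf d_V(|v-w|,0)$; if it is complete, $\mathscr M$ is a $V$-Banach $U$-module. For $\varnothing\ne S\subset\mathscr M$, $\mathscr G(S)=\{\sum_nu_n\cdot v_n:(u_n)_n\in\mathcal P(\mathbf 1_U),(v_n)_n\subset S,(u_n,v_n)_n\in\mathrm{Adm}(\mathscr M)\}$. Local dimension. Let $u\in\mathrm{Idem}(U)$ and $v_1,\dots,v_n\in\mathscr M$. They are independent on $u$ if for all $u_1,\dots,u_n\in U$: $\sum_{i=1}^n(uu_i)\cdot v_i=0$ if and only if $uu_i=0$ for every $i$. They generate $\mathscr M$ on $u$ if $\mathscr G(\langle u\cdot S\rangle_U)=u\cdot\mathscr M$, where $S=\{v_1,\dots,v_n\}$, $u\cdot S=\{u\cdot v:v\in S\}$, $u\cdot\mathscr M=\{u\cdot v:v\in\mathscr M\}$ and $\langle\cdot\rangle_U$ is the algebraically generated $U$-submodule. They form a local basis of $\mathscr M$ on $u$ if both hold. $\mathscr M$ has local dimension $n\in\mathbb N$ on $u$ if there is a local basis $v_1,\dots,v_n$ of $\mathscr M$ on $u$. *)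

(* Defs.v *)
From HB Require Import structures.
From mathcomp Require Import all_boot all_order all_algebra.
From mathcomp Require Import all_classical all_reals all_analysis.

Set Implicit Arguments.
Unset Strict Implicit.
Unset Printing Implicit Defensive.

Import Order.TTheory GRing.Theory Num.Theory.
Import numFieldNormedType.Exports.

Local Open Scope classical_set_scope.
Local Open Scope ring_scope.

Section OrderNotions.
Context {d : Order.disp_t} (P : porderType d).
Implicit Types (S : set P) (x y : P).

Definition dedekind_complete : Prop :=
  (forall S, S !=set0 -> has_ubound S -> exists x, supremums S x) /\
  (forall S, S !=set0 -> has_lbound S -> exists x, infimums S x).

Definition dedekind_sigma_complete : Prop :=
  (forall S, countable S -> S !=set0 -> has_ubound S ->
     exists x, supremums S x) /\
  (forall S, countable S -> S !=set0 -> has_lbound S ->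
     exists x, infimums S x).

Definition countably_representable : Prop :=
  [/\ dedekind_complete,
      forall S, S !=set0 -> has_ubound S ->
        exists s : nat -> P, (forall n, S (s n)) /\
          exists2 x, supremums S x & supremums (range s) x
    & forall S, S !=set0 -> has_lbound S ->
        exists s : nat -> P, (forall n, S (s n)) /\
          exists2 x, infimums S x & infimums (range s) x].

Definition order_bounded S : Prop := has_lbound S /\ has_ubound S.

End OrderNotions.

Definition sigma_order_continuous {d d' : Order.disp_t}
    (P : porderType d) (Q : porderType d') (f : P -> Q) : Prop :=
  [/\ {homo f : x y / (x <= y)%O},
      forall x : nat -> P, nondecreasing_seq x ->
        forall s, supremums (range x) s -> supremums (range (f \o x)) (f s)
    & forall x : nat -> P, nonincreasing_seq x ->
        forall s, infimums (range x) s -> infimums (range (f \o x)) (f s)].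

(* The order lives under ring_display, so [<=] in ring_scope is the order of the
   Riesz space.  Joins and meets are fields of the mixin, given by their
   universal property, because Order.Lattice has no join with Zmodule below
   Num.RealDomain in the hierarchy and cannot be inherited together with
   Lmodule. *)
HB.mixin Record isRieszSpace (R : realType) U
    & GRing.Lmodule R U & Num.POrderedZmodule U := {
  vee : U -> U -> U;
  wedge : U -> U -> U;
  vee_le : forall u v w : U, (vee u v <= w) = (u <= w) && (v <= w);
  le_wedge : forall u v w : U, (w <= wedge u v) = (w <= u) && (w <= v);
  riesz_leD2r : forall u v w : U, u <= v -> u + w <= v + w;
  riesz_scale_ge0 : forall (k : R) (u : U), 0 <= k -> 0 <= u -> 0 <= k *: u
}.

#[short(type="rieszType")]
HB.structure Definition RieszSpace (R : realType) :=
  {U of GRing.Lmodule R U & Num.POrderedZmodule U & isRieszSpace R U}.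

(* The modulus; [`|u|] of ring_scope does not apply to Riesz spaces. *)
Definition rabs {R : realType} {U : rieszType R} (u : U) : U := vee u (- u).

Definition disjoint_family {R : realType} {U : rieszType R} {I : Type}
    (f : I -> U) : Prop :=
  forall i j, i <> j -> wedge (rabs (f i)) (rabs (f j)) = 0.

HB.mixin Record isSigmaRieszSpace (R : realType) U & RieszSpace R U := {
  riesz_sigma_complete : dedekind_sigma_complete U
}.

#[short(type="sigmaRieszType")]
HB.structure Definition SigmaRieszSpace (R : realType) :=
  {U of RieszSpace R U & isSigmaRieszSpace R U}.

(* The product and the unit are fields of the mixin, since ordered types and
   ComPzRing have no join in the hierarchy below Num.NumDomain; the ring
   structure is recovered as an instance.  The zero algebra is allowed. *)
HB.mixin Record isFAlgebra (R : realType) U & RieszSpace R U := {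
  falg_one : U;
  falg_mul : U -> U -> U;
  falg_mulA : associative falg_mul;
  falg_mulC : commutative falg_mul;
  falg_mul1 : left_id falg_one falg_mul;
  falg_mulDl : left_distributive falg_mul +%R;
  falg_scaleAl : forall (k : R) (u v : U),
    k *: falg_mul u v = falg_mul (k *: u) v;
  falg_mul_ge0 : forall u v : U, 0 <= u -> 0 <= v -> 0 <= falg_mul u v;
  falg_mul_wedge : forall u v w : U,
    wedge u v = 0 -> 0 <= w -> wedge (falg_mul u w) v = 0
}.

#[short(type="fAlgType")]
HB.structure Definition FAlgebra (R : realType) :=
  {U of RieszSpace R U & isFAlgebra R U}.

#[non_forgetful_inheritance]
HB.instance Definition _ (R : realType) (U : fAlgType R) :=
  GRing.Zmodule_isComPzRing.Build U
    (@falg_mulA R U) (@falg_mulC R U) (@falg_mul1 R U) (@falg_mulDl R U).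

Section FAlgebraNotions.
Context {R : realType} {U : fAlgType R}.
Implicit Types (u : U).

Definition idem : set U := [set u | u * u = u].

Definition finite_partition u {n : nat} (e : 'I_n -> U) : Prop :=
  [/\ forall i, idem (e i), disjoint_family e & \sum_(i < n) e i = u].

Definition countable_partition u {I : countType} (e : I -> U) : Prop :=
  [/\ forall i, idem (e i), disjoint_family e & supremums (range e) u].

Definition simple_elements : set U :=
  [set u | exists n (k : 'I_n -> R) (e : 'I_n -> U),
     finite_partition 1 e /\ u = \sum_(i < n) k i *: e i].

(* The positive cone, with the induced order. *)
Definition pos_cone : Type := {u : U | 0 <= u}.

End FAlgebraNotions.
Arguments pos_cone {R} U.

HB.instance Definition _ (R : realType) (U : fAlgType R) :=
  SubType.on (pos_cone U).
HB.instance Definition _ (R : realType) (U : fAlgType R) :=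
  Choice.on (pos_cone U).
HB.instance Definition _ (R : realType) (U : fAlgType R) :=
  [SubChoice_isSubPOrder of pos_cone U by <: with ring_display].

(* [*p] is the product with the componentwise order. *)
Definition cone_mul {R : realType} {U : fAlgType R}
    (p : pos_cone U *p pos_cone U) : U := val p.1 * val p.2.

HB.mixin Record isLocalisable (R : realType) U
    & FAlgebra R U & SigmaRieszSpace R U := {
  localisable_mul : sigma_order_continuous (@cone_mul R U);
  localisable_simple : forall u : U, 0 <= u ->
    exists s : nat -> U,
      [/\ nondecreasing_seq s, forall n, simple_elements (s n),
          forall n, 0 <= s n & supremums (range s) u]
}.

#[short(type="localisableType")]
HB.structure Definition Localisable (R : realType) :=
  {U of FAlgebra R U & SigmaRieszSpace R U & isLocalisable R U}.

#[non_forgetful_inheritance]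
HB.instance Definition _ (R : realType) (U : localisableType R) :=
  GRing.ComPzRing.copy U (FAlgebra.sort U).

Definition complete_dist {R : realType} {T : Type} (dist : T -> T -> R) : Prop :=
  forall x : nat -> T,
    (forall e : R, 0 < e -> exists N, forall m n,
       (N <= m)%N -> (N <= n)%N -> dist (x m) (x n) < e) ->
    exists y, dist (x n) y @[n --> \oo] --> (0 : R).

(* The distance is a field of the mixin, for want of a join of Zmodule and
   Metric below PseudoMetricNormedZmod; the metricType structure, hence the
   topology, is recovered as an instance, with [mdist] equal to [rdist]. *)
HB.mixin Record isMetricRiesz (R : realType) U & SigmaRieszSpace R U := {
  rdist : U -> U -> R;
  rdistxx : forall u, rdist u u = 0;
  rdist_positivity : forall u v, rdist u v = 0 -> u = v;
  rdist_sym : forall u v, rdist u v = rdist v u;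
  rdist_triangle : forall v u w, rdist u w <= rdist u v + rdist v w;
  rdist_complete : complete_dist rdist;
  rdist_rabs : forall u, rdist u 0 = rdist (rabs u) 0;
  rdistD2r : forall u v w, rdist (u + w) (v + w) = rdist u v;
  rdist_le : forall u v, 0 <= u -> u <= v -> rdist u 0 <= rdist v 0
}.

#[short(type="metricRieszType")]
HB.structure Definition MetricRiesz (R : realType) :=
  {U of SigmaRieszSpace R U & isMetricRiesz R U}.

#[non_forgetful_inheritance]
HB.instance Definition _ (R : realType) (U : metricRieszType R) :=
  @isMetric.Build R U rdist rdistxx rdist_positivity rdist_sym rdist_triangle.

(* The topology of a product of metric spaces is that of the sum distance. *)
Definition continuous_op {R : realType} {A B C : metricRieszType R}
    (f : A -> B -> C) : Prop :=
  continuous (fun p : A * B => f p.1 p.2).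

Definition metric_dense {R : realType} {A : metricRieszType R} (S : set A) :
  Prop := dense S.

HB.mixin Record isMetricFAlgebra (R : realType) U
    & Localisable R U & MetricRiesz R U := {
  mfalg_mul_continuous : continuous_op (@falg_mul R U);
  mfalg_simple_dense : metric_dense (@simple_elements R U);
  mfalg_scale_cvg :
    rdist (e *: (@falg_one R U)) 0 @[e --> (0 : R)^'+] --> (0 : R)
}.

#[short(type="metricFAlgType")]
HB.structure Definition MetricFAlgebra (R : realType) :=
  {U of Localisable R U & MetricRiesz R U & isMetricFAlgebra R U}.

#[non_forgetful_inheritance]
HB.instance Definition _ (R : realType) (U : metricFAlgType R) :=
  GRing.ComPzRing.copy U (FAlgebra.sort U).
#[non_forgetful_inheritance]
HB.instance Definition _ (R : realType) (U : metricFAlgType R) :=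
  Metric.copy U (MetricRiesz.sort U).

Definition solid {R : realType} {U : rieszType R} (V : set U) : Prop :=
  forall u v : U, V u -> rabs v <= rabs u -> V v.

(* The subspaces U and V of the ambient algebra are given as types with
   injective structure-preserving maps into it whose ranges are solid.  The
   product [fs_mul] : U x V -> V is the one of the ambient algebra, by [fs_mulE];
   its well-definedness is the inclusion of UV in V. *)
Record metric_fstructure (R : realType) := MetricFStructure {
  fs_amb : localisableType R;
  fs_alg : metricFAlgType R;
  fs_vec : metricRieszType R;
  fs_ialg : {linear fs_alg -> fs_amb};
  fs_ivec : {linear fs_vec -> fs_amb};
  fs_mul : fs_alg -> fs_vec -> fs_vec;
  fs_ialg_inj : injective fs_ialg;
  fs_ialg_vee : {morph fs_ialg : u v / vee u v};
  fs_ialg_wedge : {morph fs_ialg : u v / wedge u v};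
  fs_ialg_mul : {morph fs_ialg : u v / u * v};
  fs_ialg_one : fs_ialg 1 = 1;
  fs_ialg_solid : solid (range fs_ialg);
  fs_ivec_inj : injective fs_ivec;
  fs_ivec_vee : {morph fs_ivec : u v / vee u v};
  fs_ivec_wedge : {morph fs_ivec : u v / wedge u v};
  fs_ivec_solid : solid (range fs_ivec);
  fs_mulE : forall u v, fs_ivec (fs_mul u v) = fs_ialg u * fs_ivec v;
  fs_mul_full : [set fs_mul p.1 p.2 | p in [set: fs_alg * fs_vec]] = setT;
  fs_mul_continuous : continuous_op fs_mul;
  fs_glue : forall u : nat -> fs_alg, countable_partition 1 u ->
    forall e : R, 0 < e -> exists2 r : R, 0 < r &
      forall v : nat -> fs_vec, (forall n, 0 <= v n) ->
        (\sum_(0 <= n <oo) (rdist (fs_mul (u n) (v n)) 0 : R)%:E <= r%:E)%E ->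
        order_bounded (range (fun n => fs_mul (u n) (v n))) /\
        exists2 s, supremums (range (fun n => fs_mul (u n) (v n))) s &
          rdist s 0 <= e
}.

Definition fs_CR {R : realType} (F : metric_fstructure R) : Prop :=
  [/\ countably_representable (fs_amb F), countably_representable (fs_alg F)
    & countably_representable (fs_vec F)].

Section Modules.
Context {R : realType} {F : metric_fstructure R}.
Notation U := (fs_alg F).
Notation V := (fs_vec F).
Context {M : lmodType U} (nrm : M -> V).

Definition admissible (u : nat -> U) (v : nat -> M) : Prop :=
  countable_partition 1 u /\ order_bounded (range (fun n => nrm (u n *: v n))).

Definition normed_module : Prop :=
  [/\ forall v, 0 <= nrm v,
      forall v, nrm v = 0 <-> v = 0,
      forall v w, nrm (v + w) <= nrm v + nrm w,
      forall u v, nrm (u *: v) = fs_mul (rabs u) (nrm v)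
    & forall u v, admissible u v ->
        exists w, forall n, u n *: w = u n *: v n].

Definition module_dist (v w : M) : R := rdist (nrm (v - w)) 0.

Definition banach_module : Prop :=
  normed_module /\ complete_dist module_dist.

Definition glue_closure (S : set M) : set M :=
  [set w | exists (u : nat -> U) (v : nat -> M),
     [/\ forall n, S (v n), admissible u v
       & forall n, u n *: w = u n *: v n]].

Definition module_span (S : set M) : set M :=
  [set w | exists n (a : 'I_n -> U) (s : 'I_n -> M),
     (forall i, S (s i)) /\ w = \sum_(i < n) a i *: s i].

Definition independent_on (u : U) {n : nat} (v : 'I_n -> M) : Prop :=
  forall a : 'I_n -> U,
    \sum_(i < n) (u * a i) *: v i = 0 <-> (forall i, u * a i = 0).

Definition generate_on (u : U) {n : nat} (v : 'I_n -> M) : Prop :=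
  glue_closure (module_span [set u *: s | s in range v]) =
  [set u *: w | w in setT].

Definition local_basis_on (u : U) {n : nat} (v : 'I_n -> M) : Prop :=
  independent_on u v /\ generate_on u v.

Definition has_local_dim (n : nat) (u : U) : Prop :=
  exists v : 'I_n -> M, local_basis_on u v.

End Modules.

(* The extended index set {1, 2, 3, ...} + {oo}, with [None] as oo. *)
Definition posnat : Type := {n : nat | (0 < n)%N}.
Definition ext_posnat : Type := option posnat.

(* Main.v *)
Require Import Defs.
From HB Require Import structures.
From mathcomp Require Import all_boot all_order all_algebra.
From mathcomp Require Import all_classical all_reals all_analysis.
Import Order.TTheory GRing.Theory Num.Theory.
Local Open Scope classical_set_scope.
Local Open Scope ring_scope.

(** [D_n] is the largest idempotent on which the module has local
    dimension [n], and [D_oo] is the complement of the supremum of all the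
    [D_n].  Three facts make this work.

    Local dimension passes to smaller idempotents and to countable disjoint
    suprema ([has_local_dimM], [has_local_dim_sup]); since the algebra is
    countably representable, the supremum of all idempotents of local dimension
    [n] is the supremum of a disjoint sequence of them ([idem_exhaustion]), so a
    largest one exists ([max_local_dim]).  To glue bases [v_k] living on disjoint
    idempotents [d_k], each vector is first multiplied by a small positive
    scalar, which changes neither independence nor generation; the summability
    clause of a metric f-structure then bounds the family of norms, and the
    glueing property of the module applies ([rescaled_gluing]).

    Generation up to glueing is a local property: it holds on [u] if and only if
    for each vector [w] every nonzero idempotent below [u] contains a nonzero
    idempotent on which [w] is a linear combination of the generators
    ([generate_onP]).  All arguments about bases use this form.

    Two local dimensions on the same nonzero idempotent agree
    ([local_dim_unique]): after shrinking the idempotent, the [m] vectors of one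
    basis are combinations of the [n] vectors of the other, and [m > n] rows of
    length [n] over a reduced commutative ring are dependent
    ([dependent_of_reduced]); f-algebras are reduced because squares are positive
    and the order is archimedean ([sqr_eq0_falg]).  Hence the [D_n] are disjoint.

    For uniqueness, let [D'] be another such partition.  Maximality gives
    [D'_n <= D_n]; the idempotent [D'_oo D_n] has local dimension [n] below
    [D'_oo], hence vanishes, so [D'_oo <= D_oo].  A partition of unity dominated
    termwise by another one equals it ([partition_le_eq]). *)

(** * Riesz spaces *)

Section Riesz.
Context {R : realType} {U : rieszType R}.
Implicit Types u v w : U.

Lemma rleD2r w u v : (u + w <= v + w) = (u <= v).
Proof.
apply/idP/idP => [h|]; last exact: riesz_leD2r.
by rewrite -(addrK w u) -(addrK w v); apply: riesz_leD2r.
Qed.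

Lemma rleD2l w u v : (w + u <= w + v) = (u <= v).
Proof. by rewrite ![w + _]addrC rleD2r. Qed.

Lemma rleD {u v u' v'} : u <= v -> u' <= v' -> u + u' <= v + v'.
Proof.
by move=> h h'; apply: (@le_trans _ _ (v + u')); rewrite ?rleD2r ?rleD2l.
Qed.

Lemma rsub_ge0 u v : (0 <= v - u) = (u <= v).
Proof. by rewrite -(rleD2r u 0) add0r subrK. Qed.

Lemma rle_subr w u v : (u <= v - w) = (u + w <= v).
Proof. by rewrite -(rleD2r w u) subrK. Qed.

Lemma rleN u v : (- u <= - v) = (v <= u).
Proof. by rewrite -(rleD2r (u + v) (- u)) addKr [u + v]addrC addKr. Qed.

Lemma wedge_lel u v : wedge u v <= u.
Proof. by have := lexx (wedge u v); rewrite le_wedge => /andP[]. Qed.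

Lemma wedge_ler u v : wedge u v <= v.
Proof. by have := lexx (wedge u v); rewrite le_wedge => /andP[]. Qed.

Lemma wedgexx u : wedge u u = u.
Proof. by apply/le_anti; rewrite wedge_lel le_wedge !lexx. Qed.

Lemma le_veel u v : u <= vee u v.
Proof. by have := lexx (vee u v); rewrite vee_le => /andP[]. Qed.

Lemma le_veer u v : v <= vee u v.
Proof. by have := lexx (vee u v); rewrite vee_le => /andP[]. Qed.

Lemma wedgeC u v : wedge u v = wedge v u.
Proof. by apply/le_anti; rewrite !le_wedge !wedge_ler !wedge_lel. Qed.

Lemma rabs_pos u : 0 <= u -> rabs u = u.
Proof.
move=> u0; apply/le_anti; rewrite le_veel andbT vee_le lexx /=.
by apply: (@le_trans _ _ 0) => //; rewrite -oppr0 rleN.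
Qed.

Lemma pos_neg_decomposition u : exists p n,
  [/\ 0 <= p, 0 <= n, wedge p n = 0 & u = p - n].
Proof.
exists (vee u 0), (vee u 0 - u); split; rewrite ?le_veer ?rsub_ge0 ?le_veel //.
  apply/le_anti/andP; split; last by rewrite le_wedge le_veer rsub_ge0 le_veel.
  set w := wedge _ _.
  have h : vee u 0 <= vee u 0 - w.
    rewrite vee_le; apply/andP; split; last by rewrite rsub_ge0 wedge_lel.
    by rewrite rle_subr addrC -rle_subr wedge_ler.
  by move: h; rewrite rle_subr -{2}[vee u 0]addr0 rleD2l.
by rewrite subKr.
Qed.

Lemma le_wedgeE u v : u <= v <-> wedge u v = u.
Proof.
split=> [h|<-]; last exact: wedge_ler.
by apply/le_anti; rewrite wedge_lel le_wedge lexx h.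
Qed.

End Riesz.

(** * Squares and idempotents in f-algebras *)

Section FAlg.
Context {R : realType} {U : fAlgType R}.
Implicit Types u v w e f : U.

(** Multiplying [wedge u v = 0] by [v] on one side and by [u] on the other
    keeps it, and turns both sides into [u v]. *)
Lemma wedge0_mul u v : 0 <= u -> 0 <= v -> wedge u v = 0 -> u * v = 0.
Proof.
move=> u0 v0 h.
have h1 := falg_mul_wedge _ _ _ h v0.
rewrite wedgeC in h1; have := falg_mul_wedge _ _ _ h1 u0.
by rewrite [falg_mul v u]falg_mulC wedgexx.
Qed.

Lemma fmul_ge0 u v : 0 <= u -> 0 <= v -> 0 <= u * v.
Proof. exact: falg_mul_ge0. Qed.

(** The cross terms of [(p - n)^2] vanish for the positive and negative parts. *)
Lemma fsqr_ge0 u : 0 <= u * u.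
Proof.
have [p [n [p0 n0 pn ->]]] := pos_neg_decomposition u.
have h := wedge0_mul _ _ p0 n0 pn.
have -> : (p - n) * (p - n) = p * p + n * n :> U.
  by rewrite mulrBl !mulrBr [n * p]mulrC h subr0 sub0r opprK.
by rewrite -[0]addr0; apply: rleD; apply: fmul_ge0.
Qed.

Lemma fle_mul w u v : 0 <= w -> u <= v -> u * w <= v * w.
Proof.
by move=> w0; rewrite -rsub_ge0 => h; rewrite -rsub_ge0 -mulrBl fmul_ge0.
Qed.

Lemma idem_ge0 e : idem e -> 0 <= e.
Proof. by move=> <-; apply: fsqr_ge0. Qed.

Lemma idemC e : idem e -> idem (1 - e).
Proof.
by rewrite /idem /= => h; rewrite mulrBr mulr1 mulrBl mul1r h subrr subr0.
Qed.

Lemma idem_le1 e : idem e -> e <= 1.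
Proof. by move=> h; rewrite -rsub_ge0; apply: idem_ge0; apply: idemC. Qed.

Lemma idem0 : idem (0 : U).
Proof. by rewrite /idem /= mul0r. Qed.

Lemma idem1 : idem (1 : U).
Proof. by rewrite /idem /= mul1r. Qed.

Lemma idemM e f : idem e -> idem f -> idem (e * f).
Proof. by rewrite /idem /= => he hf; rewrite mulrACA he hf. Qed.

(** Both directions rest on [0 <= e, f <= 1]. *)
Lemma idem_leP e f : idem e -> idem f -> e <= f <-> e * f = e.
Proof.
move=> he hf; split=> [h|<-].
  have e0 := idem_ge0 _ he; apply/le_anti; rewrite mulrC.
  have := fle_mul _ _ _ e0 (idem_le1 _ hf); rewrite mul1r => ->.
  by have := fle_mul _ _ _ e0 h; rewrite he.
by rewrite -{2}[f]mul1r; apply: fle_mul; [exact: idem_ge0|exact: idem_le1].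
Qed.

Lemma idemMl_le e f : idem e -> idem f -> e * f <= f.
Proof.
by move=> he hf; apply/idem_leP => //; [exact: idemM|rewrite -mulrA hf].
Qed.

Lemma idemMr_le e f : idem e -> idem f -> e * f <= e.
Proof. by move=> he hf; rewrite mulrC; apply: idemMl_le. Qed.

Lemma idem_leC e f : idem e -> idem f -> e * f = 0 -> e <= 1 - f.
Proof.
move=> he hf ef; apply/idem_leP => //; first exact: idemC.
by rewrite mulrBr mulr1 ef subr0.
Qed.

Lemma compl_leC e f : 1 - e <= f -> 1 - f <= e.
Proof. by rewrite -rsub_ge0 -[1 - f <= e]rsub_ge0 !opprB addrCA. Qed.

(** For idempotents, disjointness in the lattice is orthogonality in the ring:
    the infimum of [e] and [f] is absorbed by [e], hence lies below [e f]. *)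
Lemma idem_disjointP (I : Type) (e : I -> U) : (forall i, idem (e i)) ->
  disjoint_family e <-> (forall i j, i <> j -> e i * e j = 0).
Proof.
move=> he; split=> h i j /h.
  by rewrite !rabs_pos ?idem_ge0 //; apply: wedge0_mul; exact: idem_ge0.
rewrite !rabs_pos ?idem_ge0 // => eij; set w := wedge _ _.
have w0 : 0 <= w by rewrite le_wedge !idem_ge0.
apply/le_anti; rewrite w0 andbT.
have <- : w * e i = w.
  apply/eqP; rewrite eq_sym -subr_eq0 -{1}[w]mulr1 -mulrBr; apply/eqP/le_anti.
  rewrite fmul_ge0 ?andbT ?(idem_ge0 _ (idemC _ _)) //.
  have := fle_mul (1 - e i) w (e i) (idem_ge0 _ (idemC _ (he i)))
    (wedge_lel _ _).
  by rewrite mulrBr mulr1 [e i * (1 - _)]mulrBr mulr1 he subrr.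
have := fle_mul (e i) w (e j) (idem_ge0 _ (he i)) (wedge_ler _ _).
by rewrite [e j * _]mulrC eij.
Qed.

(** [(1 - e) f + e] is the supremum of two idempotents; an upper bound is cut
    into its parts along [1 - e] and [e]. *)
Lemma idem_join_le e f b : idem e -> e <= b -> f <= b -> (1 - e) * f + e <= b.
Proof.
move=> he eb fb; rewrite -[b](_ : b * (1 - e) + b * e = b); last first.
  by rewrite -mulrDr subrK mulr1.
rewrite [_ * f]mulrC; apply: rleD.
  by apply: fle_mul => //; apply/idem_ge0/idemC.
by rewrite -{1}he; apply: fle_mul => //; apply: idem_ge0.
Qed.

Lemma le_idem_join e f : idem e -> idem f -> f <= (1 - e) * f + e.
Proof.
move=> he hf; rewrite mulrBl mul1r -addrA -{1}[f]addr0 rleD2l addrC rsub_ge0.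
exact: idemMr_le.
Qed.

Lemma idemD e f : idem e -> idem f -> e * f = 0 -> idem (e + f).
Proof.
rewrite /idem /= => he hf ef.
by rewrite mulrDl !mulrDr he hf [f * e]mulrC ef addr0 add0r.
Qed.

Lemma idemCM e : idem e -> (1 - e) * e = 0.
Proof. by rewrite /idem /= => he; rewrite mulrBl mul1r he subrr. Qed.

Lemma idem_join e f : idem e -> idem f -> idem ((1 - e) * f + e).
Proof.
move=> he hf; apply: idemD => //; first by apply: idemM => //; apply: idemC.
by rewrite mulrAC idemCM // mul0r.
Qed.

Lemma idem_compl_ub e (b : U) : idem e -> e <= b -> 1 - e <= b -> (1 : U) <= b.
Proof.
move=> he eb ceb; have := idem_join_le (1 - e) e b (idemC _ he) ceb eb.
by rewrite subKr he [e + _]addrC subrK.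
Qed.
End FAlg.

(** * Partitions of unity in localisable f-algebras *)

Section Localisable.
Context {R : realType} {U : localisableType R}.
Implicit Types u v w e f x : U.

Lemma archimedean_le0 u b : (forall n, u *+ n <= b) -> u <= 0.
Proof.
move=> ub.
have [s [s1 s2]] : exists s, supremums (range (fun n => u *+ n)) s.
  have [H _] := @riesz_sigma_complete R U; apply: H.
  - exact: card_image_le.
  - by exists (u *+ 0), 0%N.
  - by exists b => _ [n _ <-].
have : s <= s - u.
  apply: s2 => _ [n _ <-]; rewrite rle_subr -mulrSr; apply: s1.
  by exists n.+1.
by rewrite -{1}[s]addr0 rleD2l => h; rewrite -rleN oppr0.
Qed.

(** If [v^2 = 0] then [0 <= (1 - n v)^2 = 1 - 2 n v] for all [n], so [2 v <= 0]
    because the order is archimedean; the same holds for [- v]. *)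
Lemma sqr_eq0_falg u : u * u = 0 -> u = 0.
Proof.
have half v : v * v = 0 -> v *+ 2 <= 0.
  move=> h; apply: (@archimedean_le0 _ 1) => n; rewrite mulrnAC.
  have := fsqr_ge0 (1 - v *+ n).
  rewrite mulrBr mulr1 mulrBl mul1r mulrnAr mulrnAl h !mul0rn subr0.
  by rewrite -addrA -opprD -mulr2n rsub_ge0.
move=> h; have : u *+ 2 = 0.
  by apply/le_anti; rewrite half //= -rleN oppr0 -mulNrn half // mulrNN.
rewrite -scaler_nat => /(congr1 (fun v => 2%:R^-1 *: v)).
by rewrite scalerA mulVf ?pnatr_eq0 // scale1r scaler0.
Qed.

(** Order continuity of the product, freed of the positive cone. *)
Lemma mul_sup (s t : nat -> U) u v :
  nondecreasing_seq s -> (forall n, 0 <= s n) -> supremums (range s) u ->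
  nondecreasing_seq t -> (forall n, 0 <= t n) -> supremums (range t) v ->
  supremums (range (fun n => s n * t n)) (u * v).
Proof.
move=> smono s0 [s1 s2] tmono t0 [t1 t2].
have u0 : 0 <= u by apply: le_trans (s0 0%N) _; apply: s1; exists 0%N.
have v0 : 0 <= v by apply: le_trans (t0 0%N) _; apply: t1; exists 0%N.
have [_ H _] := @localisable_mul R U.
pose cone x (x0 : 0 <= x) : pos_cone U := exist _ x x0.
pose y n : pos_cone U *p pos_cone U := (cone _ (s0 n), cone _ (t0 n)).
apply: (H y _ (cone _ u0, cone _ v0)) => [m n mn|].
  rewrite Order.ProdOrder.leEprod /=.
  by apply/andP; split; [apply: smono|apply: tmono].
split=> [_ [n _ <-]|[b1 b2] hb]; rewrite Order.ProdOrder.leEprod /=.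
  by apply/andP; split; [apply: s1|apply: t1]; exists n.
apply/andP; split; [apply: s2|apply: t2] => _ [n _ <-];
by have := hb (y n); rewrite Order.ProdOrder.leEprod /= => /(_ _)/andP[] //;
  exists n.
Qed.

Lemma supremums_unique (S : set U) x y : supremums S x -> supremums S y -> x = y.
Proof. by move=> [x1 x2] [y1 y2]; apply/le_anti; rewrite x2 ?y2. Qed.

Fixpoint joins (e : nat -> U) n : U :=
  if n is k.+1 then (1 - joins e k) * e k + joins e k else 0.

Section Joins.
Context (e : nat -> U) (he : forall n, idem (e n)).

Lemma idem_joins n : idem (joins e n).
Proof. by elim: n => [|n IH] /=; [exact: idem0|exact: idem_join]. Qed.

Definition disjointify n : U := (1 - joins e n) * e n.

Lemma idem_disjointify n : idem (disjointify n).
Proof. by apply: idemM => //; apply/idemC/idem_joins. Qed.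

Lemma joins_nondecreasing : nondecreasing_seq (joins e).
Proof.
apply/nondecreasing_seqP => n /=; rewrite -{1}[joins e n]add0r rleD2r.
exact/idem_ge0/idem_disjointify.
Qed.

Lemma ub_joins b : ubound (range e) b <-> ubound (range (joins e)) b.
Proof.
split=> h _ [n _ <-].
  elim: n => [|n IH] /=; last first.
    by apply: idem_join_le => //; [exact: idem_joins|apply: h; exists n].
  by apply: le_trans (idem_ge0 _ (he 0%N)) _; apply: h; exists 0%N.
apply: (@le_trans _ _ (joins e n.+1)); last by apply: h; exists n.+1.
by apply: le_idem_join => //; apply: idem_joins.
Qed.

(** In particular the disjointified sequence has the same supremum. *)
Lemma ub_disjointify b : ubound (range disjointify) b <-> ubound (range e) b.
Proof.
split=> h; last first.
  move=> _ [n _ <-]; apply: le_trans (h (e n) _); last by exists n.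
  by apply: idemMl_le => //; apply/idemC/idem_joins.
apply/ub_joins => _ [n _ <-].
elim: n => [|n IH] /=.
  by apply: le_trans (idem_ge0 _ (idem_disjointify 0%N)) _; apply: h; exists 0%N.
have := idem_join_le _ _ b (idem_joins n) IH (h (disjointify n) _).
by rewrite {1}/disjointify mulrA (idemC _ (idem_joins n)); apply; exists n.
Qed.

Lemma disjointify_disjoint i j : i <> j -> disjointify i * disjointify j = 0.
Proof.
have key m n : (m < n)%N -> disjointify m * disjointify n = 0.
  move=> mn; have h : disjointify m * joins e n = disjointify m.
    apply/idem_leP; [exact: idem_disjointify|exact: idem_joins|].
    apply: le_trans (joins_nondecreasing _ _ mn) => /=.
    by rewrite -{1}[disjointify m]addr0 rleD2l; apply/idem_ge0/idem_joins.
  by rewrite /disjointify -/(disjointify m) mulrA mulrBr mulr1 h subrr mul0r.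
move=> /eqP; rewrite neq_ltn => /orP[|] /key // h; by rewrite mulrC.
Qed.

(** The square of the supremum is the supremum of the squares of the finite
    joins, which are the joins themselves. *)
Lemma idem_sup s : supremums (range e) s -> idem s.
Proof.
move=> [s1 s2]; have hs : supremums (range (joins e)) s.
  by split=> [|b hb]; [apply/ub_joins|apply: s2; apply/ub_joins].
have j0 n : 0 <= joins e n by apply/idem_ge0/idem_joins.
have jmono := joins_nondecreasing.
have := mul_sup _ _ _ _ jmono j0 hs jmono j0 hs.
have -> : (fun n => joins e n * joins e n) = joins e.
  by apply/funext => n; apply: idem_joins.
by move=> h; apply: supremums_unique h hs.
Qed.

End Joins.

(** The element is the supremum of its products with the finite joins, which
    are all zero. *)
Lemma ann_partition_pos (p : nat -> U) x : (forall n, idem (p n)) ->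
  supremums (range p) 1 -> 0 <= x -> (forall n, p n * x = 0) -> x = 0.
Proof.
move=> hp [p1 p2] x0 px.
have hs : supremums (range (joins p)) 1.
  by split=> [|b hb]; [apply/(ub_joins _ hp)|apply: p2; apply/(ub_joins _ hp)].
have [|_] := mul_sup _ (fun=> x) _ x (joins_nondecreasing _ hp)
  (fun n => idem_ge0 _ (idem_joins _ hp n)) hs (fun _ _ _ => lexx x) (fun=> x0).
  by split=> [_ [n _ <-]|b hb] //; apply: hb; exists 0%N.
move=> /(_ 0); rewrite mul1r => h; apply/le_anti; rewrite x0 andbT.
apply: h => _ [n _ <-]; suff -> : joins p n * x = 0 by [].
by elim: n => [|n IH] /=; rewrite ?mul0r // mulrDl IH -mulrA px mulr0 addr0.
Qed.

(** The square is positive and also annihilated, and the algebra is reduced. *)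
Lemma ann_partition (p : nat -> U) x : (forall n, idem (p n)) ->
  supremums (range p) 1 -> (forall n, p n * x = 0) -> x = 0.
Proof.
move=> hp h px; apply: sqr_eq0_falg; apply: (ann_partition_pos p) => //.
  exact: fsqr_ge0.
by move=> n; rewrite mulrA px mul0r.
Qed.

Lemma ann_idem_sup (I : Type) (p : I -> U) s x :
  (forall i, idem (p i)) -> idem s ->
  supremums (range p) s -> idem x -> (forall i, p i * x = 0) -> s * x = 0.
Proof.
move=> hp hs [_ h] hx px.
have : s <= 1 - x by apply: h => _ [i _ <-]; apply: idem_leC.
move=> /(idem_leP _ _ hs (idemC _ hx)); rewrite mulrBr mulr1 => /eqP.
by rewrite -subr_eq0 addrAC subrr sub0r oppr_eq0 => /eqP.
Qed.

(** The complement of the supremum is put in front to obtain a partition of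
    unity indexed by the natural numbers. *)
Definition seq_partition (d : nat -> U) s n : U := if n is k.+1 then d k else 1 - s.

Lemma seq_partitionP (d : nat -> U) s : (forall n, idem (d n)) -> idem s ->
  (forall i j, i <> j -> d i * d j = 0) -> supremums (range d) s ->
  countable_partition 1 (seq_partition d s).
Proof.
move=> hd hs dd [s1 s2].
have hp n : idem (seq_partition d s n) by case: n => //; apply: idemC.
have ds n : d n * (1 - s) = 0.
  rewrite mulrBr mulr1; apply/eqP; rewrite subr_eq0 eq_sym; apply/eqP.
  by apply/idem_leP => //; apply: s1; exists n.
split=> //.
  apply/idem_disjointP => // -[|i] [|j] //= ij; first by rewrite mulrC.
  by apply: dd => e; apply: ij; rewrite e.
split=> [_ [n _ <-]|b hb]; first exact: idem_le1.
apply: (idem_compl_ub s) => //; last by apply: hb; exists 0%N.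
by apply: s2 => _ [n _ <-]; apply: hb; exists n.+1.
Qed.

(** Countable representability gives a sequence in [P] with the supremum of [P],
    and making it disjoint only shrinks its terms. *)
Lemma idem_exhaustion (P : set U) : countably_representable U ->
  P `<=` idem -> P 0 -> (forall e f, P e -> idem f -> P (f * e)) ->
  exists (d : nat -> U) s, [/\ forall n, P (d n),
    forall i j, i <> j -> d i * d j = 0, supremums (range d) s, idem s
    & forall e, P e -> e <= s].
Proof.
move=> [_ cr _] Pi P0 PM.
have [|| e [Pe [s sP se]]] := cr P; first by exists 0.
  by exists 1 => e /Pi; apply: idem_le1.
have he n : idem (e n) by apply: Pi.
exists (disjointify e), s; split.
- by move=> n; apply: PM => //; apply/idemC/idem_joins.
- exact: disjointify_disjoint.
- have [s1 s2] := se.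
  split=> [|b hb]; first exact/(ub_disjointify _ he).
  by apply: s2; apply/(ub_disjointify _ he).
- exact: idem_sup se.
- by case: sP.
Qed.

End Localisable.

(** * Linear dependence over reduced commutative rings *)

(** Gaussian elimination without division.  The element [y] records where the
    relation has to be nontrivial: a nonzero coefficient alone could be killed
    by the pivot in the next elimination step, so the induction proves
    [y * c j <> 0] and replaces [y] by [y] times the pivot.  When [y] kills the
    whole first column, [y] times a relation among the other columns works;
    that it stays nontrivial is the use of reducedness. *)
Lemma dependent_of_reduced (A : comPzRingType)
    (red : forall a : A, a * a = 0 -> a = 0)
    (n m : nat) (a : 'I_m -> 'I_n -> A) (y : A) : (n < m)%N -> y <> 0 ->
  exists c : 'I_m -> A,
    (forall i, \sum_(j < m) c j * a j i = 0) /\ exists j, y * c j <> 0.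
Proof.
elim: n m a y => [|n IH] [|m] a y //= nm y0.
  exists (fun=> 1); split=> [[]//|]; exists ord0; by rewrite mulr1.
have [[j0 yj0]|ya0] := pselect (exists j, y * a j ord0 <> 0); last first.
  have {}ya0 j : y * a j ord0 = 0.
    by apply: contrapT => h; apply: ya0; exists j.
  have [c [c1 [j cj]]] := IH m.+1 (fun j i => a j (lift ord0 i)) y (ltnW nm) y0.
  exists (fun j => y * c j); split=> [i|].
    case: (unliftP ord0 i) => [i' ->|->].
      under eq_bigr => k _ do rewrite -mulrA.
      by rewrite -mulr_sumr c1 mulr0.
    by apply: big1 => k _; rewrite mulrAC ya0 mul0r.
  exists j => h; apply: cj; apply: red.
  by rewrite -mulrA mulrCA h mulr0.
have [c [c1 [j cj]]] := IH m (fun j i => a j0 ord0 * a (lift j0 j) (lift ord0 i)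
   - a (lift j0 j) ord0 * a j0 (lift ord0 i)) _ nm yj0.
(* The relation between the rows [a j0 ord0 * row j - a j ord0 * row j0],
   rewritten as a relation between the original rows. *)
pose c' j := if unlift j0 j is Some k then a j0 ord0 * c k
  else - \sum_(k < m) c k * a (lift j0 k) ord0.
have c'l k : c' (lift j0 k) = a j0 ord0 * c k by rewrite /c' fintype.liftK.
have c'0 : c' j0 = - \sum_(k < m) c k * a (lift j0 k) ord0.
  by rewrite /c' unlift_none.
exists c'; split=> [i|]; last by exists (lift j0 j); rewrite c'l mulrA.
rewrite (bigD1_ord j0) //= c'0; under eq_bigr => k _ do rewrite c'l.
rewrite mulNr mulr_suml -sumrN -big_split /=.
case: (unliftP ord0 i) => [i' ->|->]; last first.
  by apply: big1 => k _; rewrite addrC -mulrA [a j0 ord0 * _]mulrC subrr.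
rewrite -[RHS](c1 i'); apply: eq_bigr => k _.
by rewrite mulrBr addrC !mulrA [c k * a j0 ord0]mulrC.
Qed.

(** * Metric f-structures *)

Section FStructure.
Context {R : realType} (F : metric_fstructure R).
Notation U := (fs_alg F).
Notation V := (fs_vec F).
Notation ia := (@fs_ialg R F).
Notation iv := (@fs_ivec R F).

Lemma ialg_le u v : (ia u <= ia v) <-> (u <= v).
Proof.
rewrite !le_wedgeE -fs_ialg_wedge; split=> [|->] //; exact: fs_ialg_inj.
Qed.

Lemma ivec_le u v : (iv u <= iv v) <-> (u <= v).
Proof.
rewrite !le_wedgeE -fs_ivec_wedge; split=> [|->] //; exact: fs_ivec_inj.
Qed.

Lemma ialg_idem e : idem e -> idem (ia e).
Proof. by rewrite /idem /= => he; rewrite -fs_ialg_mul he. Qed.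

(** By solidity an upper bound in the ambient algebra, once cut off at [1],
    comes from the subalgebra. *)
Lemma ialg_sup1 (p : nat -> U) : (forall n, idem (p n)) ->
  supremums (range p) 1 -> supremums (range (ia \o p)) 1.
Proof.
move=> hp [p1 p2]; have hip n := ialg_idem _ (hp n).
split=> [_ [n _ <-]|b hb]; first exact: idem_le1 (hip n).
have c0 : 0 <= wedge b 1.
  apply: (@le_trans _ _ (ia (p 0%N))); first exact: idem_ge0 (hip _).
  by rewrite le_wedge hb //=; [exact: idem_le1 (hip _)|exists 0%N].
have [c _ cE] : range ia (wedge b 1).
  apply: (@fs_ialg_solid _ F 1); first by exists 1 => //; exact: fs_ialg_one.
  by rewrite !rabs_pos ?(idem_ge0 _ idem1) // wedge_ler.
apply: le_trans (wedge_lel b 1); rewrite -cE -(@fs_ialg_one _ F) ialg_le.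
apply: p2 => _ [n _ <-]; rewrite -ialg_le cE le_wedge hb /=; last by exists n.
exact: idem_le1 (hip _).
Qed.

(** The claim is moved to the ambient algebra, where both factors live. *)
Lemma fs_ann_partition (p : nat -> U) (x : V) :
  countable_partition 1 p -> 0 <= x ->
  (forall n, fs_mul (p n) x = 0) -> x = 0.
Proof.
move=> [hp _ p1] x0 px; apply: (@fs_ivec_inj _ F); rewrite linear0.
apply: (ann_partition_pos (ia \o p)).
- by move=> n; exact: ialg_idem.
- exact: ialg_sup1.
- by rewrite -(linear0 iv) ivec_le.
- by move=> n; rewrite /= -fs_mulE px linear0.
Qed.

Lemma fs_mul_ge0 u x : 0 <= u -> 0 <= x -> 0 <= fs_mul u x :> V.
Proof.
move=> u0 x0; rewrite -ivec_le linear0 fs_mulE.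
by apply: fmul_ge0; [rewrite -(linear0 ia) ialg_le|rewrite -(linear0 iv) ivec_le].
Qed.

Lemma fs_mul_idem_le e x : idem e -> 0 <= x -> fs_mul e x <= x :> V.
Proof.
move=> he x0; rewrite -ivec_le fs_mulE -[leRHS]mul1r.
apply: fle_mul; last by apply: idem_le1; exact: ialg_idem.
by rewrite -(linear0 iv) ivec_le.
Qed.

Lemma fs_mul0l x : fs_mul 0 x = 0 :> V.
Proof. by apply: (@fs_ivec_inj _ F); rewrite fs_mulE !linear0 mul0r. Qed.

(** [t 1] tends to [0], and the product is continuous at [(0, x)]. *)
Lemma small_scalar (x : V) (e : R) : 0 < e ->
  exists2 t : R, 0 < t & rdist (fs_mul (t *: @falg_one R U) x) 0 < e.
Proof.
move=> e0.
have c1 : (t *: @falg_one R U) @[t --> (0:R)^'+] --> (0 : U).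
  apply/metricType_numDomainType.cvgrPdist_lt => r r0.
  have /cvgrPdist_lt/(_ r r0) := @mfalg_scale_cvg R U.
  apply: filterS => t; rewrite sub0r normrN ger0_norm; last first.
    exact: (@mdist_ge0 R U (t *: falg_one) 0).
  by rewrite /mdist /= rdist_sym.
have c2 : (t *: @falg_one R U, x) @[t --> (0:R)^'+] --> ((0 : U), x).
  have c0 : (fun _ : R => x) @ (0:R)^'+ --> x by exact: cvg_cst.
  exact: (cvg_pair c1 c0).
have c3 := cvg_comp _ _ c2 (@fs_mul_continuous R F (0, x)).
move: c3 => /metricType_numDomainType.cvgrPdist_lt/(_ e e0) c3.
near (0:R)^'+ => t; exists t.
  by near: t; exact: nbhs_right_gt.
have : mdist (fs_mul (0:U) x) (fs_mul (t *: @falg_one R U) x) < e by near: t.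
by rewrite fs_mul0l /mdist /= rdist_sym.
Unshelve. all: by end_near.
Qed.
End FStructure.

(** * Glueing in normed modules *)

Section Module.
Context {R : realType} {F : metric_fstructure R}.
Context {M : lmodType (fs_alg F)} {nrm : M -> fs_vec F}.
Context (nM : normed_module nrm).
Notation U := (fs_alg F).
Notation V := (fs_vec F).

Lemma nrm_ge0 (v : M) : 0 <= nrm v. Proof. by case: nM. Qed.

Lemma nrmZ (u : U) (v : M) : 0 <= u -> nrm (u *: v) = fs_mul u (nrm v).
Proof. by move=> u0; case: nM => _ _ _ -> _; rewrite rabs_pos. Qed.

Lemma module_ann (p : nat -> U) (v : M) : countable_partition 1 p ->
  (forall n, p n *: v = 0) -> v = 0.
Proof.
move=> pp pv; have [_ n0 _ _ _] := nM; apply/n0.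
apply: (fs_ann_partition _ _ _ pp (nrm_ge0 v)) => n.
by have [hp _ _] := pp; rewrite -nrmZ ?pv ?(idem_ge0 _ (hp n)) //; apply/n0.
Qed.

(** The norm of a glued vector bounds the norms of all its pieces. *)
Lemma glued_admissible (p : nat -> U) (v : nat -> M) (w : M) :
  countable_partition 1 p -> (forall n, p n *: w = p n *: v n) ->
  admissible nrm p v.
Proof.
move=> pp pw; split=> //; split; first by exists 0 => _ [n _ <-]; exact: nrm_ge0.
have [hp _ _] := pp.
exists (nrm w) => _ [n _ <-]; rewrite -pw nrmZ ?(idem_ge0 _ (hp n)) //.
exact: fs_mul_idem_le (hp n) (nrm_ge0 w).
Qed.

(** Any sequence of vectors can be glued after scaling by small positive reals
    [t n]: choose them so that the distances are summable with a sum below the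
    threshold of the f-structure.  The factors [c n = t n 1] are
    invertible, so scaling preserves local bases. *)
Lemma rescaled_gluing (p : nat -> U) (v : nat -> M) : countable_partition 1 p ->
  exists (c c' : nat -> U) (w : M), (forall n, c' n * c n = 1) /\
    forall n, p n *: w = p n *: (c n *: v n).
Proof.
move=> pp; have [hp _ _] := pp.
have [r r0 glue] := @fs_glue R F p pp 1 ltr01.
have [t t0] : {t : nat -> R & forall n, 0 < t n /\
    rdist (fs_mul (t n *: @falg_one R U) (nrm (v n))) 0 < r / (2 ^ n.+1)%:R}.
  apply: (@choice _ _ (fun n t => 0 < t /\
    rdist (fs_mul (t *: @falg_one R U) (nrm (v n))) 0 < r / (2 ^ n.+1)%:R)) => n.
  have [|t ? ?] := small_scalar F (nrm (v n)) (r / (2 ^ n.+1)%:R).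
    by rewrite divr_gt0 // ltr0n expn_gt0.
  by exists t.
pose c n : U := t n *: falg_one; pose c' n : U := (t n)^-1 *: falg_one.
have c0 n : 0 <= c n.
  by apply: riesz_scale_ge0; [apply: ltW; case: (t0 n)|exact: idem_ge0 idem1].
have y0 n : 0 <= fs_mul (c n) (nrm (v n)) by apply: fs_mul_ge0 (c0 n) (nrm_ge0 _).
have [|bnd _] := glue (fun n => fs_mul (c n) (nrm (v n))) y0.
  apply: le_trans (epsilon_trick0 xpredT (ltW r0)).
  apply: lee_nneseries => n _; rewrite lee_fin.
    by move=> _; exact: mdist_ge0.
  apply: le_trans (ltW (t0 n).2).
  apply: rdist_le; last exact: fs_mul_idem_le.
  by apply: fs_mul_ge0 => //; exact: idem_ge0.
have [_ _ _ _ gl] := nM.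
have [|w wE] := gl p (fun n => c n *: v n).
  split=> //.
  rewrite (_ : (fun n => nrm _) =
    fun n => fs_mul (p n) (fs_mul (c n) (nrm (v n)))) //; apply/funext => n.
  by rewrite !nrmZ ?(idem_ge0 _ (hp n)).
exists c, c', w; split=> // n.
rewrite /c /c'
  [_ * _](_ : _ = falg_mul ((t n)^-1 *: falg_one) (t n *: falg_one)) //.
rewrite -falg_scaleAl falg_mul1 scalerA mulVf ?scale1r // gt_eqF //.
by case: (t0 n).
Qed.
End Module.

(** * Generation is a local property *)

Section LocalBasis.
Context {R : realType} {F : metric_fstructure R}.
Context {M : lmodType (fs_alg F)} {nrm : M -> fs_vec F}.
Context (nM : normed_module nrm) (crU : countably_representable (fs_alg F)).
Notation U := (fs_alg F).
Notation V := (fs_vec F).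

(** Coefficients of repeated generators are collected. *)
Lemma module_spanP (u : U) (n : nat) (v : 'I_n -> M) (w : M) :
  module_span [set u *: s | s in range v] w <->
  exists a : 'I_n -> U, w = \sum_(i < n) (a i * u) *: v i.
Proof.
split=> [[m [b [s [hs ->]]]]|[a ->]]; last first.
  exists n, a, (fun i => u *: v i); split=> [i|].
    by exists (v i) => //; exists i.
  by apply: eq_bigr => i _; rewrite scalerA.
have [f fE] : {f : 'I_m -> 'I_n & forall j, s j = u *: v (f j)}.
  apply: (@choice _ _ (fun j i => s j = u *: v i)) => j.
  by have [_ [i _ <-] <-] := hs j; exists i.
exists (fun i => \sum_(j < m | f j == i) b j).
rewrite (partition_big f xpredT) //=; apply: eq_bigr => i _.
rewrite mulr_suml scaler_suml; apply: eq_bigr => j /eqP <-.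
by rewrite fE scalerA.
Qed.

Definition locally_generates (u : U) (n : nat) (v : 'I_n -> M) : Prop :=
  forall (w : M) (x : U), idem x -> x <> 0 -> x * u = x ->
  exists (e : U) (a : 'I_n -> U), [/\ idem e, e <> 0, e * x = e
    & e *: w = \sum_(i < n) (e * a i) *: v i].

Lemma partition_meets (p : nat -> U) (x : U) : countable_partition 1 p ->
  x <> 0 -> exists n, p n * x <> 0.
Proof.
move=> [hp _ p1] x0; apply: contrapT => h; apply: x0.
apply: (ann_partition p) => // n; apply: contrapT => h'; apply: h; by exists n.
Qed.

(** From left to right, some member of the glueing partition meets the given
    idempotent.  From right to left, the idempotents on which [u w] is in the
    span are exhausted by a disjoint sequence; its supremum contains [1 - u],
    where [u w] vanishes, and the local condition leaves no room below [u], so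
    the sequence is a partition of unity along which [u w] is glued. *)
Lemma generate_onP (u : U) (n : nat) (v : 'I_n -> M) : idem u ->
  generate_on nrm u v <-> locally_generates u n v.
Proof.
move=> hu; split=> [gen w x hx x0 xu|gen].
  have : [set u *: w | w in setT] (u *: w) by exists w.
  rewrite -gen => -[p [s [hs [pp _] ps]]].
  have [k pk0] := partition_meets p x pp x0.
  have [hp _ _] := pp.
  have /module_spanP[a aE] := hs k.
  exists (p k * x), a; split=> //; first exact: idemM.
    by rewrite -mulrA hx.
  rewrite -{1}xu mulrA -scalerA mulrC -scalerA ps aE scalerA scaler_sumr.
  apply: eq_bigr => i _; rewrite scalerA; congr (_ *: _).
  by rewrite -{2}xu mulrA mulrAC [x * u * _]mulrAC.
apply/seteqP; split=> [w [p [s [hs [pp _] ps]]]|_ [w _ <-]].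
  exists w => //; apply/eqP; rewrite -subr_eq0; apply/eqP.
  apply: (module_ann nM p) => // k.
  have us : u *: s k = s k.
    have /module_spanP[a ->] := hs k.
    rewrite scaler_sumr; apply: eq_bigr => i _.
    by rewrite scalerA mulrC -mulrA hu.
  rewrite scalerBr.
  have -> : p k *: (u *: w) = p k *: s k.
    by rewrite scalerA mulrC -scalerA ps scalerA mulrC -scalerA us.
  by rewrite ps subrr.
pose P e := idem e /\ exists a : 'I_n -> U,
  e *: (u *: w) = e *: \sum_(i < n) (a i * u) *: v i.
have [||| d [s [dP dd ds hs Ps]]] := idem_exhaustion P crU.
- by move=> e [].
- by split; [exact: idem0|exists (fun=> 0); rewrite !scale0r].
- move=> e f [he [a aE]] hf; split; first exact: idemM.
  by exists a; rewrite -!scalerA aE.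
have hd k : idem (d k) by case: (dP k).
have [a aE] : {a : nat -> 'I_n -> U & forall k,
    d k *: (u *: w) = d k *: \sum_(i < n) (a k i * u) *: v i}.
  apply: (@choice _ _ (fun k a =>
    d k *: (u *: w) = d k *: \sum_(i < n) (a i * u) *: v i)) => k.
  by case: (dP k).
have s1 : s = 1.
  apply/eqP; rewrite eq_sym -subr_eq0; apply/eqP; apply: contrapT => s0.
  have hcs := idemC _ hs.
  have su : (1 - s) * u = 1 - s.
    have : P (1 - u).
      split; first exact: idemC.
      exists (fun=> 0); rewrite scalerA idemCM // scale0r.
      by rewrite big1 ?scaler0 // => i _; rewrite mul0r scale0r.
    by move=> /Ps/compl_leC/(idem_leP _ _ hcs hu).
  have [e [b [he e0 ex eE]]] := gen w _ hcs s0 su.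
  apply: e0; have : P e.
    split=> //; exists b; rewrite scaler_sumr.
    rewrite scalerA mulrC -scalerA eE scaler_sumr; apply: eq_bigr => i _.
    by rewrite !scalerA [u * _]mulrC -mulrA.
  move=> /Ps/(idem_leP _ _ he hs) es.
  by rewrite -ex mulrBr mulr1 es subrr.
have pp := seq_partitionP d s hd hs dd ds.
pose S k : M := if k is k'.+1 then \sum_(i < n) (a k' i * u) *: v i else 0.
have pS k : seq_partition d s k *: (u *: w) = seq_partition d s k *: S k.
  by case: k => [|k] /=; [rewrite s1 subrr !scale0r|exact: aE].
exists (seq_partition d s), S; split=> //; last first.
  exact: (glued_admissible nM) pp pS.
case=> [|k]; apply/module_spanP; last by exists (a k).
by exists (fun=> 0); rewrite big1 // => i _; rewrite mul0r scale0r.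
Qed.
End LocalBasis.

(** * Local dimension *)

Section Partitions.
Context {R : realType} {U : localisableType R}.

(** [D i - D' i] is an idempotent annihilated by every member of the partition
    [D']. *)
Lemma partition_le_eq (I : countType) (D D' : I -> U) :
  countable_partition 1 D -> countable_partition 1 D' ->
  (forall i, D' i <= D i) -> D = D'.
Proof.
move=> [hD /(idem_disjointP _ _ hD) dD _].
move=> [hD' /(idem_disjointP _ _ hD') dD' D1] le.
apply/funext => i; have D'D j : D' j * D j = D' j by apply/idem_leP.
apply/eqP; rewrite -subr_eq0; apply/eqP.
have E : D i - D' i = (1 - D' i) * D i by rewrite mulrBl mul1r D'D.
rewrite -[LHS]mul1r; apply: (ann_idem_sup _ D') => //; first exact: idem1.
  by rewrite E; apply: idemM => //; exact: idemC.
move=> j; have [->|ij] := pselect (j = i).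
  by rewrite E mulrA [D' i * _]mulrC idemCM // mul0r.
by rewrite mulrBr dD' // subr0 -D'D -mulrA dD // mulr0.
Qed.
End Partitions.

Section LocalDimension.
Context {R : realType} {F : metric_fstructure R}.
Context {M : lmodType (fs_alg F)} {nrm : M -> fs_vec F}.
Context (nM : normed_module nrm) (crU : countably_representable (fs_alg F)).
Notation U := (fs_alg F).

Lemma independent_onP (u : U) (n : nat) (v : 'I_n -> M) :
  independent_on u v <->
  forall a : 'I_n -> U,
    \sum_(i < n) (u * a i) *: v i = 0 -> forall i, u * a i = 0.
Proof.
split=> h a; first by move=> /h.
by split=> [/h//|ua]; rewrite big1 // => i _; rewrite ua scale0r.
Qed.

Lemma has_local_dimP (n : nat) (u : U) : idem u ->
  has_local_dim nrm n u <->
  exists v : 'I_n -> M, independent_on u v /\ locally_generates u n v.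
Proof.
move=> hu; split=> -[v [iv gv]]; exists v; split=> //;
exact/(generate_onP nM crU u n v hu).
Qed.

(** Every family is a local basis on [0]; this starts the exhaustion. *)
Lemma has_local_dim0 (n : nat) : has_local_dim nrm n (0 : U).
Proof.
apply/has_local_dimP; first exact: idem0.
exists (fun=> 0); split; first by apply/independent_onP => a _ i; rewrite mul0r.
by move=> w x _ x0; rewrite mulr0 => /esym.
Qed.

Lemma has_local_dimM (n : nat) (e f : U) : idem e -> idem f ->
  has_local_dim nrm n e -> has_local_dim nrm n (f * e).
Proof.
move=> he hf /(has_local_dimP _ _ he)[v [/independent_onP iv gv]].
apply/has_local_dimP; first exact: idemM.
exists v; split; first apply/independent_onP => a.
  have E i : f * e * a i = e * (f * a i) by rewrite mulrA [e * f]mulrC.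
  by under eq_bigr => i _ do rewrite E; move=> /iv h i; rewrite E.
move=> w x hx x0 xfe; apply: gv => //.
by rewrite -xfe -!mulrA he.
Qed.

(** Shrinking [u] once for each of the [m] vectors [w] makes them genuine
    combinations of the [n] vectors [v] on a nonzero idempotent [x].  A relation
    between the rows of coefficients, nontrivial on [x], contradicts the
    independence of [w]. *)
Lemma local_dim_le (m n : nat) (u : U) : idem u -> (n < m)%N ->
  has_local_dim nrm n u -> has_local_dim nrm m u -> u = 0.
Proof.
move=> hu nm /(has_local_dimP _ _ hu)[v [_ gv]].
move=> /(has_local_dimP _ _ hu)[w [/independent_onP iw _]].
apply: contrapT => u0.
have [x [a [hx x0 xu aE]]] : exists (x : U) (a : 'I_m -> 'I_n -> U),
    [/\ idem x, x <> 0, x * u = x & forall j, j \in enum 'I_m ->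
      x *: w j = \sum_(i < n) (x * a j i) *: v i].
  elim: (enum 'I_m) => [|j s [x [a [hx x0 xu aE]]]].
    by exists u, (fun _ _ => 0); split.
  have [e [b [he e0 ex eE]]] := gv (w j) x hx x0 xu.
  exists e, (fun k => if k == j then b else a k); split=> // [|k].
    by rewrite -ex -mulrA xu.
  rewrite in_cons; have [->|_] := eqVneq k j => //= ks.
  rewrite -ex -scalerA aE // scaler_sumr; apply: eq_bigr => i _.
  by rewrite scalerA mulrA.
have [c [ca [j]]] := dependent_of_reduced _ (@sqr_eq0_falg _ U) n m a x nm x0.
have E k : u * (x * c k) = x * c k by rewrite mulrA [u * x]mulrC xu.
apply; rewrite -E; apply: (iw (fun k => x * c k)).
under eq_bigr => k _.
  rewrite E mulrC -scalerA aE ?mem_enum // scaler_sumr.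
  under eq_bigr => i _ do rewrite scalerA mulrCA.
  over.
rewrite exchange_big /= big1 // => i _.
by rewrite -scaler_suml -mulr_sumr ca mulr0 scale0r.
Qed.

Lemma local_dim_unique (m n : nat) (u : U) : idem u -> m <> n ->
  has_local_dim nrm n u -> has_local_dim nrm m u -> u = 0.
Proof.
move=> hu /eqP; rewrite neq_ltn => /orP[] h hn hm.
  exact: local_dim_le h hm hn.
exact: local_dim_le h hn hm.
Qed.

(** Each [w i] is glued from rescaled vectors [c i k *: v k i]; on [d k] the
    families [w] and [v k] differ by invertible factors, and both independence
    and local generation can be tested on the [d k]. *)
Lemma has_local_dim_sup (n : nat) (d : nat -> U) (s : U) :
  (forall k, idem (d k)) -> (forall i j, i <> j -> d i * d j = 0) ->
  supremums (range d) s -> idem s ->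
  (forall k, has_local_dim nrm n (d k)) -> has_local_dim nrm n s.
Proof.
move=> hd dd ds hs dn.
have [v vP] : {v : nat -> 'I_n -> M & forall k,
    independent_on (d k) (v k) /\ locally_generates (d k) n (v k)}.
  apply: (@choice _ _ (fun k v =>
    independent_on (d k) v /\ locally_generates (d k) n v)).
  by move=> k; apply/has_local_dimP.
have pp := seq_partitionP d s hd hs dd ds.
have sd k : d k * s = d k by apply/idem_leP => //; apply: ds.1; exists k.
have [g gE] : {g : 'I_n -> (nat -> U) * (nat -> U) * M & forall i,
    (forall k, (g i).1.2 k * (g i).1.1 k = 1) /\
    forall k, d k *: (g i).2 = d k *: ((g i).1.1 k *: v k i)}.
  apply: (@choice _ _ (fun i (g : (nat -> U) * (nat -> U) * M) =>
    (forall k, g.1.2 k * g.1.1 k = 1) /\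
    forall k, d k *: g.2 = d k *: (g.1.1 k *: v k i))) => i.
  have [c [c' [w [cc wE]]]] := rescaled_gluing nM _
    (fun k => if k is k'.+1 then v k' i else 0) pp.
  exists ((fun k => c k.+1), (fun k => c' k.+1), w).
  split=> k /=; first exact: cc.
  exact: wE k.+1.
pose c i := (g i).1.1; pose c' i := (g i).1.2; pose w i := (g i).2.
have cc i k : c' i k * c i k = 1 by exact: (gE i).1.
have wE i k : d k *: w i = d k *: (c i k *: v k i) by exact: (gE i).2.
apply/has_local_dimP => //; exists w; split.
  apply/independent_onP => a sa i.
  have da k : d k * a i = 0.
    have /independent_onP iv := (vP k).1.
    have : d k * (a i * c i k) = 0.
      apply: (iv (fun i => a i * c i k)).
      transitivity (d k *: \sum_(j < n) (s * a j) *: w j); last first.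
        by rewrite sa scaler0.
      rewrite scaler_sumr; apply: eq_bigr => j _.
      rewrite mulrA [RHS]scalerA [in RHS]mulrA sd [d k * a j]mulrC.
      by rewrite -[in RHS]scalerA wE !scalerA.
    move=> /(congr1 (fun z => z * c' i k)).
    by rewrite mul0r -!mulrA [c i k * _]mulrC cc mulr1.
  apply: (ann_partition (seq_partition d s)); try by case: pp.
  by case=> [|k] /=; rewrite mulrA ?idemCM ?mul0r // sd.
move=> y x hx x0 xs.
have [k kx] : exists k, d k * x <> 0.
  apply: contrapT => h; apply: x0; rewrite -xs mulrC.
  apply: (ann_idem_sup _ d) => // k; apply: contrapT => h'; apply: h; by exists k.
have [|||e [a [he e0 ex eE]]] := (vP k).2 y (d k * x); first exact: idemM.
- by [].
- by rewrite mulrAC hd.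
have ed : e * d k = e by rewrite -ex -mulrA mulrAC hd.
have ew i : e *: w i = (e * c i k) *: v k i.
  by rewrite -ed -scalerA wE !scalerA.
exists e, (fun i => a i * c' i k); split=> //.
  by rewrite -ex -!mulrA hx.
rewrite eE; apply: eq_bigr => i _.
rewrite [in RHS]mulrC -[in RHS]scalerA ew scalerA mulrACA cc mulr1.
by rewrite mulrC.
Qed.

Lemma max_local_dim (n : nat) : exists s : U, [/\ idem s, has_local_dim nrm n s
  & forall e : U, idem e -> has_local_dim nrm n e -> e <= s].
Proof.
have [||| d [s [dP dd ds hs sP]]] :=
    idem_exhaustion [set e : U | idem e /\ has_local_dim nrm n e] crU.
- by move=> e [].
- by split; [exact: idem0|exact: has_local_dim0].
- by move=> e f [he hn] hf; split; [exact: idemM|exact: has_local_dimM].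
exists s; split=> // [|e he hn]; last exact: sP.
by apply: (has_local_dim_sup n d) => // k; case: (dP k).
Qed.
End LocalDimension.

Theorem theorem3p44 (R : realType) (F : metric_fstructure R) (F_CR : fs_CR F)
    (M : lmodType (fs_alg F)) (nrm : M -> fs_vec F)
    (M_banach : banach_module nrm) :
  exists! D : ext_posnat -> fs_alg F,
    [/\ countable_partition 1 D,
        forall n : posnat, has_local_dim nrm (val n) (D (Some n))
      & forall (n : posnat) (u : fs_alg F),
          idem u -> u <> 0 -> u <= D None -> ~ has_local_dim nrm (val n) u].
Proof.
have [_ crU _] := F_CR; have [nM _] := M_banach.
have [S SP] : {S : posnat -> fs_alg F & forall n : posnat,
    [/\ idem (S n), has_local_dim nrm (val n) (S n)
  & forall e, idem e -> has_local_dim nrm (val n) e -> e <= S n]}.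
  apply: (@choice _ _ (fun (n : posnat) s =>
    [/\ idem s, has_local_dim nrm (val n) s
    & forall e, idem e -> has_local_dim nrm (val n) e -> e <= s])).
  by move=> n; exact: max_local_dim.
have hS n : idem (S n) by case: (SP n).
have SS n m : n <> m -> S n * S m = 0.
  move=> nm; apply: (local_dim_unique nM crU (val n) (val m)).
  - exact: idemM.
  - by move=> /val_inj.
  - by apply: has_local_dimM => //; case: (SP m).
  - by rewrite mulrC; apply: has_local_dimM => //; case: (SP n).
(* The supremum [t] of the [S n], as that of the idempotents below some [S n]. *)
have [||| d [t [dP dd dt ht tP]]] :=
    idem_exhaustion [set e : fs_alg F | idem e /\ exists n, e * S n = e] crU.
- by move=> e [].
- by split; [exact: idem0|exists (exist _ 1%N isT); rewrite mul0r].
- move=> e f [he [n en]] hf; split; first exact: idemM.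
  by exists n; rewrite -mulrA en.
have St n : S n <= t by apply: tP; split=> //; exists n; exact: hS.
have tS b : (forall n, S n <= b) -> t <= b.
  move=> Sb; apply: dt.2 => _ [k _ <-]; have [hd [n dn]] := dP k.
  by apply: le_trans (Sb n); apply/idem_leP.
pose D (i : ext_posnat) := if i is Some n then S n else 1 - t.
have hD i : idem (D i) by case: i => [n|] //=; exact: idemC.
have DP : countable_partition 1 D.
  split=> //.
    apply/idem_disjointP => // -[n|] [m|] //= nm.
    - by apply: SS => e; apply: nm; rewrite e.
    - by rewrite mulrBr mulr1 (idem_leP _ _ (hS n) ht).1 // subrr.
    - by rewrite mulrC mulrBr mulr1 (idem_leP _ _ (hS m) ht).1 // subrr.
  split=> [_ [i _ <-]|b hb]; first exact: idem_le1.
  apply: (idem_compl_ub t) => //; last by apply: hb; exists None.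
  by apply: tS => n; apply: hb; exists (Some n).
exists D; split; first split=> //.
- by move=> n; case: (SP n).
- move=> n u hu u0 /= ut hn; apply: u0.
  have uS : u <= S n by case: (SP n) => _ _; apply.
  have := (idem_leP _ _ hu (idemC _ ht)).1 ut.
  by rewrite mulrBr mulr1 (idem_leP _ _ hu ht).1 ?subrr // (le_trans uS).
move=> D' [DP' D'n D'o]; apply: partition_le_eq => // -[n|] /=.
  by have [hD' _ _] := DP'; case: (SP n) => _ _; apply.
have [hD' _ _] := DP'.
apply: idem_leC => //; rewrite mulrC; apply: (ann_idem_sup _ d) => // [k|k].
  by case: (dP k).
have [hd [n dn]] := dP k; rewrite -dn -mulrA.
(* [S n * D' None] has local dimension [n] and lies below [D' None]. *)
suff -> : S n * D' None = 0 by rewrite mulr0.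
apply: contrapT => h; apply: (D'o n _ _ h).
- exact: idemM.
- exact: idemMl_le.
by rewrite mulrC; apply: has_local_dimM => //; case: (SP n).
Qed.
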